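(* The following hold. (1) (Testing case.) Assume $Q=0$ (and $k<n$). Then $\mathcal L_{\phi,x}$ does not satisfy Hörmander's condition. (2) Assume that $a_0,a_1,\dots,a_n$ are pairwise distinct and that for each $i\in\{1,\dots,n\}$ there is an $m\in\{0,\dots,n\}$, $m\neq i$, such that $q_{mi}>0$ and such that, for all $p,j\in\{0,\dots,n\}$, $q_{pj}>0$ and $a_p-a_j=a_m-a_i$ imply $j=i$. Then $\mathcal L_{\phi,x}$ satisfies Hörmander's condition. (3) Assume that for every $j\in\{1,\dots,n\}$ one has $q_{mj}=0$ for all $m\in\{0,\dots,n\}$ with $m\ne j$, and that $q_{j0}>0$ for at least one $j\in\{1,\dots,n\}$. If $n\ge3$, then $\mathcal L_{\phi,x}$ does not satisfy Hörmander's condition. If $n=2$ (and hence $k=1$), then $\mathcal L_{\phi,x}$ satisfies Hörmander's condition if and only if $$q_{10}+\tfrac12\|a_1\|^2+\lambda_0\cdot a_1\ne q_{20}+\tfrac12\|a_2\|^2+\lambda_0\cdot a_2 .$$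
   Context: Let $1\le k<n$ be integers. Let $Q=(q_{ij})_{i,j=0}^n$ be a real matrix with $q_{ij}\ge0$ for $i\ne j$, $q_{ii}\le0$, and $\sum_{j=0}^nq_{ij}=0$ for every $i$. Let $\lambda_0,\dots,\lambda_n\in\mathbb R^k$ be pairwise distinct, with $\lambda_0$ a vertex of their convex hull; write $\lambda_{ir}$ for the $r$-th component of $\lambda_i$. Put $a_i:=\lambda_i-\lambda_0$ for $0\le i\le n$ (so $a_0=0$), with components $a_{ir}$ ($1\le r\le k$), and $\Sigma_{ij}:=a_i\cdot a_j$. For $\phi\in(0,\infty)^n$ let $\phi_0:=1$ and $y(\phi):=1+\sum_{i=1}^n\phi_i$. Define vector fields on $(0,\infty)^n$: $$D_r=\sum_{j=1}^na_{jr}\phi_j\,\partial_{\phi_j}\ (1\le r\le k),\qquad D_0=\sum_{j=1}^n\Big(\frac1{y(\phi)}\sum_{i=1}^n\Sigma_{ij}\phi_i\phi_j-\frac12\|a_j\|^2\phi_j\Big)\partial_{\phi_j},$$ $$J=\sum_{j=1}^n\sum_{i=0}^n(q_{ij}-q_{i0}\phi_j)\phi_i\,\partial_{\phi_j},\qquad D_0^J=D_0+J.$$ On $(0,\infty)^n\times\mathbb R^k$ (coordinates $(\phi,x)$) define $$\tilde\lambda_r(\phi)=\frac1{y(\phi)}\Big(\lambda_{0r}+\sum_{i=1}^n\lambda_{ir}\phi_i\Big),\quad \tilde D_r=D_r+\partial_{x_r},\quad \hat D_0=D_0^J+\sum_{r=1}^k\tilde\lambda_r(\phi)\,\partial_{x_r},\quad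 \mathcal L_{\phi,x}=\hat D_0+\frac12\sum_{r=1}^k\tilde D_r^2.$$ Lie bracket: $[F,G]=FG-GF$. $\mathcal L_{\phi,x}$ satisfies Hörmander's condition if at every point of $(0,\infty)^n\times\mathbb R^k$ the values of $\hat D_0,\tilde D_1,\dots,\tilde D_k$ and of all their iterated Lie brackets span $\mathbb R^{n+k}$. *)

(* Defs.v *)
From mathcomp Require Import all_boot all_order all_algebra.
From mathcomp Require Import all_classical all_reals all_analysis.

Set Implicit Arguments.
Unset Strict Implicit.
Unset Printing Implicit Defensive.

Import Order.TTheory GRing.Theory Num.Theory.
Import numFieldNormedType.Exports.

Local Open Scope classical_set_scope.
Local Open Scope ring_scope.

Section VectorFields.
Context {R : realType} {N : nat}.

(* A vector field on an open subset of R^N is given by its coefficients, as a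
   total function; its values outside the open set are irrelevant, since the
   bracket below only depends on the germs of its arguments. *)
Definition vfield : Type := 'rV[R]_N -> 'rV[R]_N.

Definition vapp (F : vfield) (f : 'rV[R]_N -> R) : 'rV[R]_N -> R :=
  fun z => 'D_(F z) f z.

(* The first-order operator FG - GF is determined by its values on the
   coordinate functions, which F and G send to their own coefficients. *)
Definition lie_bracket (F G : vfield) : vfield :=
  fun z => \row_j (vapp F (fun w => G w ord0 j) z
                   - vapp G (fun w => F w ord0 j) z).

Inductive iterated_bracket (gen : set vfield) : vfield -> Prop :=
| iterated_bracket_gen F : gen F -> iterated_bracket gen F
| iterated_bracket_lie F G :
    iterated_bracket gen F -> iterated_bracket gen G ->
    iterated_bracket gen (lie_bracket F G).

Definition linear_span (A : set 'rV[R]_N) : set 'rV[R]_N :=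
  [set v | exists2 s : seq 'rV[R]_N, [set` s] `<=` A & v \in span s].

(* Hörmander's condition on U for X0 + 1/2 \sum_(r < k) (X r)^2; the drift X0
   itself is one of the generators. *)
Definition hormander (k : nat) (U : set 'rV[R]_N) (X0 : vfield)
    (X : 'I_k -> vfield) : Prop :=
  forall z, U z ->
    linear_span [set F z | F in iterated_bracket ([set X0] `|` range X)]
      = setT.

End VectorFields.

Section ConvexHull.
Context {R : realType} {k : nat}.

Definition convex_hull (m : nat) (p : 'I_m -> 'rV[R]_k) : set 'rV[R]_k :=
  [set v | exists w : 'I_m -> R,
    [/\ forall i, 0 <= w i, \sum_i w i = 1 & v = \sum_i w i *: p i]].

Definition vertex (C : set 'rV[R]_k) (v : 'rV[R]_k) : Prop :=
  C v /\ forall x y t, C x -> C y -> 0 < t < 1 ->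
    v = t *: x + (1 - t) *: y -> x = v /\ y = v.

End ConvexHull.

Definition dotr {R : realType} {k : nat} (u v : 'rV[R]_k) : R :=
  \sum_(r < k) u ord0 r * v ord0 r.

Section Fields.
Context {R : realType} {n k : nat}.
Variables (q : 'M[R]_n.+1) (lam : 'I_n.+1 -> 'rV[R]_k).

(* The indices 0, ..., n are 'I_n.+1.  The vector phi = (phi_1, ..., phi_n) is
   indexed by 'I_n, with j : 'I_n standing for the index lift ord0 j, i.e.
   j + 1, of 'I_n.+1. *)

Definition avec (i : 'I_n.+1) : 'rV[R]_k := lam i - lam ord0.

Definition Sig (i j : 'I_n.+1) : R := dotr (avec i) (avec j).

Definition ext_phi (phi : 'rV[R]_n) (i : 'I_n.+1) : R :=
  if unlift ord0 i is Some j then phi ord0 j else 1.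

Definition yphi (phi : 'rV[R]_n) : R := 1 + \sum_(i < n) phi ord0 i.

Definition D (r : 'I_k) : @vfield R n := fun phi =>
  \row_j (avec (lift ord0 j) ord0 r * phi ord0 j).

Definition D0 : @vfield R n := fun phi =>
  \row_j ((yphi phi)^-1
            * \sum_(i < n)
                Sig (lift ord0 i) (lift ord0 j) * phi ord0 i * phi ord0 j
          - 2^-1 * dotr (avec (lift ord0 j)) (avec (lift ord0 j))
            * phi ord0 j).

Definition J : @vfield R n := fun phi =>
  \row_j \sum_(i < n.+1)
    (q i (lift ord0 j) - q i ord0 * phi ord0 j) * ext_phi phi i.

Definition D0J : @vfield R n := fun phi => D0 phi + J phi.

Definition lam_tilde (r : 'I_k) (phi : 'rV[R]_n) : R :=
  (yphi phi)^-1
    * (lam ord0 ord0 r + \sum_(i < n) lam (lift ord0 i) ord0 r * phi ord0 i).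

(* A point (phi, x) of R^n x R^k is row_mx phi x. *)

Definition orthant_times_space : set 'rV[R]_(n + k) :=
  [set z | forall j : 'I_n, 0 < lsubmx z ord0 j].

Definition Dtilde (r : 'I_k) : @vfield R (n + k) := fun z =>
  row_mx (D r (lsubmx z)) (delta_mx ord0 r).

Definition Dhat0 : @vfield R (n + k) := fun z =>
  row_mx (D0J (lsubmx z)) (\row_r lam_tilde r (lsubmx z)).

Definition L_hormander : Prop := hormander orthant_times_space Dhat0 Dtilde.

End Fields.

(* Main.v *)
(* Subtracting the combination \sum_r lam_tilde_r Dtilde_r from Dhat0 leaves a
   field E without x-components whose phi-part is [J h], where h is q with
   |a_j|^2 / 2 + lam_0 . a_j subtracted from the j-th diagonal entry. Modulo the
   Dtilde_r, iterated brackets of Dhat0 with the Dtilde_r are those of E, and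
   [Dtilde_r, J h] = J ((a_i - a_j)_r h_ij): the entries h_ij are eigenvectors
   with joint eigenvalue a_i - a_j.
   In (2), polynomials in the ad Dtilde_r isolate a single nonzero entry h_mi
   for every i, which yields all the coordinate fields of the orthant.
   In (1) and (3), E is a functional combination of the commuting fields
   \sum_j b_j phi_j d_j (b_j constant) and \sum_j phi_j d_j; the module over
   smooth functions spanned by commuting fields is closed under brackets, so the
   rank is at most k plus the number of such fields. For n = 2 these two fields
   give full rank exactly when b_1 != b_2, the Euler field being obtained by
   bracketing E twice with some Dtilde_r. *)
Require Import Defs.
From mathcomp Require Import all_boot all_order all_algebra.
From mathcomp Require Import all_classical all_reals all_analysis.
From mathcomp Require Import ring.

Set Implicit Arguments.
Unset Strict Implicit.
Unset Printing Implicit Defensive.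

Import Order.TTheory GRing.Theory Num.Theory.
Import numFieldNormedType.Exports.

Local Open Scope classical_set_scope.
Local Open Scope ring_scope.

(** * Differentiability and directional derivatives *)

Lemma near_eq_differentiable (R : numFieldType) (V W : normedModType R)
    (f g : V -> W) (z : V) :
  (\near z, f z = g z) -> differentiable f z -> differentiable g z.
Proof.
move=> fg df; have [dfc dfe] := (diff_locallyP _ _).1 df.
suff dge : g \o shift z = cst (g z) + 'd f z +o_ 0 id.
  by apply/diff_locallyP; rewrite (diff_unique dfc dge).
have fgz := nbhs_singleton fg.
apply/eqaddoP => e e0; have /eqaddoP/(_ e e0) := dfe.
move: fg; rewrite (near_shift 0) subr0; apply: filterS2 => w /= fgw.
by rewrite !fctE /= -fgw -fgz.
Qed.

(* Unlike [rowP], with the index [ord0] used in the definitions. *)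
Lemma row_ext (T : Type) (N : nat) (u v : 'rV[T]_N) :
  (forall i, u ord0 i = v ord0 i) -> u = v.
Proof. by move=> uv; apply/rowP => i; exact: uv. Qed.

Section Derivations.
Context {R : realType} {N : nat}.
Implicit Types (f g : 'rV[R]_N -> R) (u v z : 'rV[R]_N).

Lemma derive_dir_sum (I : finType) f z (c : I -> R) (v : I -> 'rV[R]_N) :
  differentiable f z ->
  'D_(\sum_i c i *: v i) f z = \sum_i c i * 'D_(v i) f z.
Proof.
move=> df; rewrite deriveE// linear_sum; apply: eq_bigr => i _.
by rewrite linearZ/= deriveE.
Qed.

Lemma derive_coord i j z v : 'D_v (fun w : 'rV[R]_N => w i j) z = v i j.
Proof.
(* The coordinate map is repackaged as a linear map, so that [diff_lin] makes it its own
   differential. *)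
have @f : {linear 'rV[R]_N -> R}.
  by exists (fun N : 'M[R]_(_, _) => N i j); do 2![eexists]; do ?[constructor];
     rewrite ?mxE// => ? *; rewrite ?mxE//; move=> ?; rewrite !mxE.
rewrite deriveE; last exact: differentiable_coord.
have -> : (fun w : 'rV[R]_N => w i j) = f by [].
by rewrite diff_lin//; exact: coord_continuous.
Qed.

Lemma derive_add f g z v : differentiable f z -> differentiable g z ->
  'D_v (fun w => f w + g w) z = 'D_v f z + 'D_v g z.
Proof. by move=> df dg; apply: deriveD; exact: diff_derivable. Qed.

Lemma derive_mul f g z v : differentiable f z -> differentiable g z ->
  'D_v (fun w => f w * g w) z = f z * 'D_v g z + g z * 'D_v f z.
Proof. by move=> df dg; apply: deriveM; exact: diff_derivable. Qed.

Lemma differentiable_bigsum (I : Type) (r : seq I) (f : I -> 'rV[R]_N -> R) z :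
  (forall i, differentiable (f i) z) ->
  differentiable (fun w => \sum_(i <- r) f i w) z.
Proof.
move=> df; elim: r => [|i r IH].
  by under eq_fun do rewrite big_nil; exact: differentiable_cst.
under eq_fun do rewrite big_cons.
exact: (differentiableD (df i) IH).
Qed.

Lemma derive_bigsum (I : Type) (r : seq I) (f : I -> 'rV[R]_N -> R) z v :
  (forall i, differentiable (f i) z) ->
  'D_v (fun w => \sum_(i <- r) f i w) z = \sum_(i <- r) 'D_v (f i) z.
Proof.
move=> df; elim: r => [|i r IH].
  by under eq_fun do rewrite big_nil; rewrite derive_cst big_nil.
under eq_fun do rewrite big_cons.
rewrite derive_add ?IH ?big_cons//; exact: differentiable_bigsum.
Qed.

End Derivations.

(** * Linear spans of sets of vectors *)

Section LinearSpan.
Context {R : realType} {N : nat}.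
Implicit Types (A : set 'rV[R]_N) (v : 'rV[R]_N).

Lemma linear_span_sub A v : A v -> linear_span A v.
Proof.
move=> Av; exists [:: v]; last by rewrite memv_span1.
by move=> w /=; rewrite inE => /eqP->.
Qed.

Lemma linear_span0 A : linear_span A 0.
Proof. by exists [::]; [move=> w|exact: mem0v]. Qed.

Lemma linear_spanD A u v :
  linear_span A u -> linear_span A v -> linear_span A (u + v).
Proof.
move=> [s sA us] [t tA vt]; exists (s ++ t); last by rewrite span_cat memv_add.
by move=> w /=; rewrite mem_cat => /orP[/sA|/tA].
Qed.

Lemma linear_spanZ A c v : linear_span A v -> linear_span A (c *: v).
Proof. by move=> [s sA vs]; exists s => //; exact: memvZ. Qed.

Lemma linear_spanB A u v :
  linear_span A u -> linear_span A v -> linear_span A (u - v).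
Proof.
by move=> Au Av; rewrite -scaleN1r; apply: linear_spanD => //; exact: linear_spanZ.
Qed.

Lemma linear_span_sum A (I : finType) (v : I -> 'rV[R]_N) :
  (forall i, linear_span A (v i)) -> linear_span A (\sum_i v i).
Proof.
by move=> Av; elim/big_ind : _ => //; [exact: linear_span0|exact: linear_spanD].
Qed.

(** Dimension count: the span lies in [W], whose dimension is at most [#|I|]. *)
Lemma linear_span_proper A (I : finType) (w : I -> 'rV[R]_N) :
  (#|I| < N)%N ->
  (forall v, A v -> exists c : I -> R, v = \sum_i c i *: w i) ->
  linear_span A != setT.
Proof.
move=> IN Aw; apply/eqP => AT.
pose W := <<[seq w i | i <- enum I]>>%VS.
suff : (N <= \dim W)%N.
  apply/negP; rewrite -ltnNge; apply: leq_ltn_trans IN.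
  by rewrite (leq_trans (dim_span _))// size_map -cardE.
have {1}<- : \dim {: 'rV[R]_N} = N by rewrite dimvf /dim/= mul1n.
apply: dimvS; apply/subvP => v _.
have [s sA vs] : linear_span A v by rewrite AT.
move: v vs; apply/subvP/span_subvP => v /sA/Aw[c ->].
apply: memv_suml => i _; apply: memvZ; apply: memv_span.
by apply/mapP; exists i => //; rewrite mem_enum.
Qed.

End LinearSpan.

(** * Regular functions on the orthant *)

Section RegularFunctions.
Context {R : realType} {n k : nat}.
Local Notation U := (@orthant_times_space R n k).
Implicit Types (f g : 'rV[R]_(n + k) -> R) (z : 'rV[R]_(n + k)).

Lemma near_orthant z : U z -> \forall w \near z, U w.
Proof.
move=> Uz.
suff coord_near (j : 'I_n) : \forall w \near z, 0 < lsubmx w ord0 j.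
  exact: filter_forall coord_near.
have := Uz j; rewrite mxE => zj.
have cj := @coord_continuous R 1 (n + k) ord0 (lshift k j) z.
by apply: filterS (cvgr_gt _ cj _ zj) => w; rewrite mxE.
Qed.

(** The orthant is open, so identities valid only there, such as those dividing by [yphi], may be
    differentiated. *)
Lemma eq_derive_orthant f g z v : U z -> (forall w, U w -> f w = g w) ->
  'D_v f z = 'D_v g z.
Proof.
move=> Uz fg; apply: near_eq_derive.
by apply: filterS (near_orthant Uz) => w; exact: fg.
Qed.

Lemma eq_differentiable_orthant f g z : U z -> (forall w, U w -> f w = g w) ->
  differentiable f z -> differentiable g z.
Proof.
move=> Uz fg; apply: near_eq_differentiable.
by apply: filterS (near_orthant Uz) => w; exact: fg.
Qed.

Lemma yphi_gt0 z : U z -> 0 < yphi (lsubmx z).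
Proof.
move=> Uz; rewrite /yphi ltr_pwDl// sumr_ge0// => i _; exact/ltW/Uz.
Qed.

(* An algebra of functions smooth on the orthant that contains every
   coefficient below and is stable under differentiation. *)
Inductive regular : ('rV[R]_(n + k) -> R) -> Prop :=
| regular_cst c : regular (fun=> c)
| regular_phi j : regular (fun z => lsubmx z ord0 j)
| regular_yinv : regular (fun z => (yphi (lsubmx z))^-1)
| regularD f g : regular f -> regular g -> regular (fun z => f z + g z)
| regularM f g : regular f -> regular g -> regular (fun z => f z * g z)
| regular_ext f g : (forall z, U z -> f z = g z) -> regular f -> regular g.

Lemma regular_sum (I : Type) (r : seq I) (f : I -> 'rV[R]_(n + k) -> R) :
  (forall i, regular (f i)) -> regular (fun z => \sum_(i <- r) f i z).
Proof.
move=> rf; elim: r => [|i r IH].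
  by under eq_fun do rewrite big_nil; exact: regular_cst.
by under eq_fun do rewrite big_cons; exact: regularD.
Qed.

Lemma regularN f : regular f -> regular (fun z => - f z).
Proof.
move=> rf; under eq_fun do rewrite -mulN1r.
by apply: regularM => //; exact: regular_cst.
Qed.

Lemma regularB f g : regular f -> regular g -> regular (fun z => f z - g z).
Proof. by move=> rf rg; apply: regularD => //; exact: regularN. Qed.

Lemma differentiable_phi j z :
  differentiable (fun w : 'rV[R]_(n + k) => lsubmx w ord0 j) z.
Proof. by under eq_fun do rewrite mxE; exact: differentiable_coord. Qed.

Lemma derive_phi j z v :
  'D_v (fun w : 'rV[R]_(n + k) => lsubmx w ord0 j) z = lsubmx v ord0 j.
Proof. by under eq_fun do rewrite mxE; rewrite derive_coord mxE. Qed.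

Lemma differentiable_yphi z :
  differentiable (fun w : 'rV[R]_(n + k) => yphi (lsubmx w)) z.
Proof.
have := differentiable_bigsum (index_enum 'I_n) (fun j => differentiable_phi j z).
exact: (differentiableD (differentiable_cst _ _)).
Qed.

Lemma derive_yphi z v :
  'D_v (fun w : 'rV[R]_(n + k) => yphi (lsubmx w)) z = \sum_(j < n) lsubmx v ord0 j.
Proof.
have dphi j := differentiable_phi j z.
rewrite /yphi derive_add//; last exact: differentiable_bigsum.
rewrite derive_cst add0r derive_bigsum//.
by apply: eq_bigr => j _; exact: derive_phi.
Qed.

Lemma differentiable_regular f z : U z -> regular f -> differentiable f z.
Proof.
move=> Uz; elim=> {f} [c|j||f g _ df _ dg|f g _ df _ dg|f g fg _ df].
- exact: differentiable_cst.
- exact: differentiable_phi.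
- apply: differentiableV; first exact: differentiable_yphi.
  by rewrite gt_eqF// yphi_gt0.
- exact: (differentiableD df dg).
- exact: (differentiableM df dg).
- exact: eq_differentiable_orthant fg df.
Qed.

Lemma regular_derive (F : 'rV[R]_(n + k) -> 'rV[R]_(n + k)) f :
  (forall i, regular (fun z => F z ord0 i)) -> regular f ->
  regular (fun z => 'D_(F z) f z).
Proof.
move=> rF; have rF' j : regular (fun z => lsubmx (F z) ord0 j).
  by under eq_fun do rewrite mxE.
elim=> {f} [c|j||f g rf df rg dg|f g rf df rg dg|f g fg rf df].
- by under eq_fun do rewrite derive_cst; exact: regular_cst.
- by under eq_fun do rewrite derive_phi.
(* The derivative of [1 / y] is regular because [y] is affine in [phi]; the formula is only claimed
   on the orthant, where [y] is positive. *)
- apply: (@regular_ext (fun z => - ((yphi (lsubmx z))^-1 * (yphi (lsubmx z))^-1)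
             * \sum_(j < n) lsubmx (F z) ord0 j)).
    move=> z Uz; have y0 : yphi (lsubmx z) != 0 by rewrite gt_eqF// yphi_gt0.
    have dy := diff_derivable (v := F z) (differentiable_yphi z).
    have := @deriveV _ _ (fun w : 'rV_(n + k) => yphi (lsubmx w)) z (F z) y0 dy.
    by rewrite derive_yphi -invfM -expr2 => ->.
  apply: regularM; last exact: regular_sum.
  by apply/regularN/regularM; exact: regular_yinv.
- apply: regular_ext (regularD df dg) => z Uz.
  by rewrite derive_add//; exact: differentiable_regular.
- apply: regular_ext (regularD (regularM rf dg) (regularM rg df)) => z Uz.
  by rewrite derive_mul//; exact: differentiable_regular.
- by apply: regular_ext df => z Uz; exact: eq_derive_orthant.
Qed.

End RegularFunctions.

(** * Modules spanned by commuting fields *)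

Section CommutingFrame.
Context {R : realType} {n k : nat} (I : finType).
Local Notation U := (@orthant_times_space R n k).
Variable K : I -> @vfield R (n + k).
Hypothesis K_regular : forall s i, regular (fun z => K s z ord0 i).
Hypothesis K_comm : forall s t i z, U z ->
  vapp (K s) (fun w => K t w ord0 i) z = vapp (K t) (fun w => K s w ord0 i) z.

Definition in_frame (F : @vfield R (n + k)) : Prop :=
  exists2 f : I -> 'rV[R]_(n + k) -> R, forall s, regular (f s) &
    forall z, U z -> F z = \sum_s f s z *: K s z.

Lemma derive_frame F f z g : U z -> F z = \sum_s f s z *: K s z -> regular g ->
  'D_(F z) g z = \sum_s f s z * 'D_(K s z) g z.
Proof.
by move=> Uz -> rg; rewrite derive_dir_sum//; exact: differentiable_regular.
Qed.

(* The terms [f_s g_t [K_s, K_t]] of the bracket vanish, so only derivatives of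
   the coefficients remain. *)
Lemma in_frame_bracket F G : in_frame F -> in_frame G -> in_frame (lie_bracket F G).
Proof.
move=> [f rf Ff] [g rg Gg].
(* [dir h b] differentiates [b] along [\sum_t h_t K_t]; keeping the sum explicit makes its
   regularity visible. *)
pose dir (h : I -> 'rV[R]_(n + k) -> R) b z := \sum_t h t z * 'D_(K t z) b z.
exists (fun s z => dir f (g s) z - dir g (f s) z).
  move=> s; apply: regularB; apply: regular_sum => t; apply: regularM => //.
    exact: regular_derive.
  exact: regular_derive.
move=> z Uz; apply: row_ext => i; rewrite mxE /vapp summxE.
have deriv P p : (forall s, regular (p s)) ->
    (forall z, U z -> P z = \sum_s p s z *: K s z) -> forall v,
    'D_v (fun w => P w ord0 i) z =
     \sum_s ('D_v (p s) z * K s z ord0 i + p s z * 'D_v (fun w => K s w ord0 i) z).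
  move=> rp Pp v.
  rewrite (eq_derive_orthant _ Uz
    (g := fun w => \sum_s p s w * K s w ord0 i)); last first.
    by move=> w Uw; rewrite Pp// summxE; apply: eq_bigr => s _; rewrite mxE.
  rewrite derive_bigsum; last first.
    by move=> s; apply: differentiable_regular => //; exact: regularM.
  apply: eq_bigr => s _; rewrite derive_mul; [|exact: differentiable_regular..].
  by rewrite addrC mulrC.
have FD := derive_frame Uz (Ff z Uz); have GD := derive_frame Uz (Gg z Uz).
rewrite (deriv G g)// (deriv F f)// !big_split/= opprD addrACA.
rewrite [X in _ + X](_ : _ = 0) ?addr0; last first.
  apply/eqP; rewrite subr_eq0; apply/eqP.
  under eq_bigr => s _ do rewrite (FD _ (K_regular s i)) mulr_sumr.
  under [RHS]eq_bigr => s _ do rewrite (GD _ (K_regular s i)) mulr_sumr.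
  rewrite exchange_big; apply: eq_bigr => s _; apply: eq_bigr => t _ /=.
  by have := K_comm s t i Uz; rewrite /vapp => ->; rewrite mulrCA.
rewrite -sumrB; apply: eq_bigr => s _.
by rewrite !mxE mulrBl (FD _ (rg s)) (GD _ (rf s)).
Qed.

(** Every iterated bracket stays in the frame, so at any point its values lie in the span of [#|I|]
    vectors; one point, here with all coordinates 1, refutes the condition. *)
Lemma not_hormander_frame (X0 : @vfield R (n + k)) (X : 'I_k -> @vfield R (n + k)) :
  (#|I| < n + k)%N -> in_frame X0 -> (forall r, in_frame (X r)) ->
  ~ hormander U X0 X.
Proof.
move=> card FX0 FX; pose z : 'rV[R]_(n + k) := const_mx 1.
have Uz : U z by move=> j; rewrite !mxE.
move=> /(_ z Uz)/eqP; apply/negP; apply: (@linear_span_proper _ _ _ _ (K^~ z)) => //.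
move=> _ [F Fbr <-].
suff [f _ Ff] : in_frame F by exists (f^~ z); exact: Ff.
elim: Fbr => {F} [F [->//|[r _ <-]//]|F G _ FF _ FG]; exact: in_frame_bracket.
Qed.

End CommutingFrame.

(** * Reduction of the drift modulo the fields [Dtilde] *)

Section Fields.
Context {R : realType} {n k : nat} (q : 'M[R]_n.+1) (lam : 'I_n.+1 -> 'rV[R]_k).
Local Notation U := (@orthant_times_space R n k).
Local Notation a := (avec lam).
Implicit Types (z : 'rV[R]_(n + k)) (h : 'M[R]_n.+1) (phi : 'rV[R]_n).

Lemma avec0 : a ord0 = 0. Proof. exact: subrr. Qed.

Lemma ext_phi_lift phi j : ext_phi phi (lift ord0 j) = phi ord0 j.
Proof. by rewrite /ext_phi liftK. Qed.

Lemma ext_phi_gt0 z p : U z -> 0 < ext_phi (lsubmx z) p.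
Proof. by move=> Uz; rewrite /ext_phi; case: unliftP. Qed.

Lemma regular_ext_phi p : regular (fun z => ext_phi (lsubmx z) p).
Proof.
rewrite /ext_phi; case: unliftP => [j _|_]; [exact: regular_phi|exact: regular_cst].
Qed.

Lemma regular_lam_tilde r : regular (fun z => lam_tilde lam r (lsubmx z)).
Proof.
apply: regularM; first exact: regular_yinv.
apply: regularD; first exact: regular_cst.
by apply: regular_sum => i; apply: regularM; [exact: regular_cst|exact: regular_phi].
Qed.

(** In the coordinates [(log phi, x)] these are the constant fields, hence they commute. With
    [c = 1] and [x = 0] this is the Euler field in [phi]. *)
Definition linear_field (c : 'I_n -> R) (x : 'rV[R]_k) : @vfield R (n + k) :=
  fun z => row_mx (\row_j (c j * lsubmx z ord0 j)) x.

Lemma Dtilde_linear r :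
  Dtilde lam r = linear_field (fun j => a (lift ord0 j) ord0 r) (delta_mx ord0 r).
Proof. by []. Qed.

Lemma linear_fieldEl c x z j :
  linear_field c x z ord0 (lshift k j) = c j * lsubmx z ord0 j.
Proof. by rewrite row_mxEl mxE. Qed.

Lemma linear_fieldEr c x z r : linear_field c x z ord0 (rshift n r) = x ord0 r.
Proof. by rewrite row_mxEr. Qed.

Lemma regular_linear_field c x i : regular (fun z => linear_field c x z ord0 i).
Proof.
case: (split_ordP i) => j ->.
  under eq_fun do rewrite linear_fieldEl.
  by apply: regularM; [exact: regular_cst|exact: regular_phi].
by under eq_fun do rewrite linear_fieldEr; exact: regular_cst.
Qed.

Lemma linear_field_comm c x d y i z :
  vapp (linear_field c x) (fun w => linear_field d y w ord0 i) z =
  vapp (linear_field d y) (fun w => linear_field c x w ord0 i) z.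
Proof.
have dl b u v j : 'D_v (fun w => linear_field b u w ord0 (lshift k j)) z =
    b j * lsubmx v ord0 j.
  under eq_fun do rewrite linear_fieldEl.
  rewrite derive_mul; [|exact: differentiable_cst|exact: differentiable_phi].
  by rewrite derive_cst mulr0 addr0 derive_phi.
have dr b u v r : 'D_v (fun w => linear_field b u w ord0 (rshift n r)) z = 0.
  by under eq_fun do rewrite linear_fieldEr; rewrite derive_cst.
rewrite /vapp; case: (split_ordP i) => j ->; last by rewrite !dr.
by rewrite !dl !row_mxKl !mxE mulrCA.
Qed.

(* In the coordinates log phi_j, the summand of [J h] with coefficient [h i j]
   is multiplied by [a_i - a_j] under the bracket with [D]. *)
Definition weight (r : 'I_k) (i j : 'I_n.+1) : R := a i ord0 r - a j ord0 r.

Definition J0 h : @vfield R (n + k) := fun z => row_mx (J h (lsubmx z)) 0.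

Lemma J0El h z j : J0 h z ord0 (lshift k j) =
  \sum_(i < n.+1) (h i (lift ord0 j) - h i ord0 * lsubmx z ord0 j)
    * ext_phi (lsubmx z) i.
Proof. by rewrite row_mxEl mxE. Qed.

Lemma J0Er h z r : J0 h z ord0 (rshift n r) = 0.
Proof. by rewrite row_mxEr mxE. Qed.

Lemma regular_J0 h i : regular (fun z => J0 h z ord0 i).
Proof.
case: (split_ordP i) => j ->.
  under eq_fun do rewrite J0El.
  apply: regular_sum => p; apply: regularM; last exact: regular_ext_phi.
  apply: regularB; first exact: regular_cst.
  by apply: regularM; [exact: regular_cst|exact: regular_phi].
by under eq_fun do rewrite J0Er; exact: regular_cst.
Qed.

Lemma J0D h h' z : J0 (h + h') z = J0 h z + J0 h' z.
Proof.
rewrite /J0 add_row_mx addr0; congr row_mx; apply: row_ext => j.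
by rewrite !mxE -big_split/=; apply: eq_bigr => i _; rewrite !mxE; ring.
Qed.

Lemma J0Z c h z : J0 (c *: h) z = c *: J0 h z.
Proof.
rewrite /J0 scale_row_mx scaler0; congr row_mx; apply: row_ext => j.
by rewrite !mxE mulr_sumr; apply: eq_bigr => i _; rewrite !mxE; ring.
Qed.

Lemma derive_ext_phi p z v :
  'D_v (fun w : 'rV[R]_(n + k) => ext_phi (lsubmx w) p) z =
  if unlift ord0 p is Some j then lsubmx v ord0 j else 0.
Proof.
rewrite /ext_phi; case: unliftP => [j _|_]; first exact: derive_phi.
exact: derive_cst.
Qed.

Lemma derive_ext_phi_Dtilde r p z :
  'D_(Dtilde lam r z) (fun w : 'rV[R]_(n + k) => ext_phi (lsubmx w) p) z =
  a p ord0 r * ext_phi (lsubmx z) p.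
Proof.
rewrite derive_ext_phi row_mxKl /ext_phi; case: unliftP => [j ->|->].
  by rewrite mxE.
by rewrite avec0 mxE mul0r.
Qed.

Lemma differentiable_ext_phi p z :
  differentiable (fun w : 'rV[R]_(n + k) => ext_phi (lsubmx w) p) z.
Proof.
rewrite /ext_phi; case: unliftP => [j _|_]; first exact: differentiable_phi.
exact: differentiable_cst.
Qed.

(** Differentiation multiplies [phi_i] by [a_i] and [phi_i phi_j] by [a_i + a_j], and the other half
    of the bracket subtracts [a_j]. Since [a_0 = 0], the quadratic terms get [a_i - a_0], so column
    0 obeys the same rule as the others. *)
Lemma lie_bracket_Dtilde_J0 r h z : U z ->
  lie_bracket (Dtilde lam r) (J0 h) z = J0 (\matrix_(i, j) (weight r i j * h i j)) z.
Proof.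
move=> Uz; apply: row_ext => i; rewrite mxE /vapp.
case: (split_ordP i) => j ->; last first.
  under eq_fun do rewrite J0Er; rewrite derive_cst J0Er.
  rewrite Dtilde_linear; under eq_fun do rewrite linear_fieldEr.
  by rewrite derive_cst subrr.
have -> : 'D_(J0 h z) (fun w => Dtilde lam r w ord0 (lshift k j)) z =
    a (lift ord0 j) ord0 r * J0 h z ord0 (lshift k j).
  rewrite Dtilde_linear; under eq_fun do rewrite linear_fieldEl.
  rewrite derive_mul; [|exact: differentiable_cst|exact: differentiable_phi].
  by rewrite derive_cst mulr0 addr0 derive_phi [lsubmx _ _ _]mxE.
under eq_fun do rewrite J0El.
have dphi := differentiable_phi j z.
have dcst c : differentiable (fun=> c : R) z := differentiable_cst c z.
have dc p : differentiable (fun w : 'rV[R]_(n + k) =>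
    h p (lift ord0 j) - h p ord0 * lsubmx w ord0 j) z.
  exact: (differentiableB (dcst _) (differentiableM (dcst _) dphi)).
have dext p := differentiable_ext_phi p z.
rewrite derive_bigsum; last by move=> p; exact: (differentiableM (dc p) (dext p)).
rewrite !J0El mulr_sumr -sumrB; apply: eq_bigr => p _.
rewrite derive_mul// derive_ext_phi_Dtilde.
under eq_fun do rewrite -mulNr.
rewrite derive_add//; last exact: (differentiableM (dcst _) dphi).
rewrite derive_mul// !derive_cst derive_phi row_mxKl !mxE /weight avec0 !mxE.
ring.
Qed.

(* [c_j] is such that [c_0 = 0] and [- c_j] is the part of the logarithmic drift
   of [phi_j] left by [Dhat0 - \sum_r lam_tilde_r Dtilde_r] besides [J]. *)
Definition logdrift (j : 'I_n.+1) : R :=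
  2^-1 * dotr (a j) (a j) + dotr (lam ord0) (a j).

Definition reduced : 'M[R]_n.+1 := \matrix_(i, j) (q i j - logdrift j *+ (i == j)).

Lemma logdrift0 : logdrift ord0 = 0.
Proof.
rewrite /logdrift /dotr !big1 ?mulr0 ?addr0// => r _; by rewrite avec0 !mxE mulr0.
Qed.

Lemma reduced0 i : reduced i ord0 = q i ord0.
Proof. by rewrite mxE; case: eqP => [->|_]; rewrite ?logdrift0 subr0. Qed.

Lemma lam_tildeE r z : U z -> lam_tilde lam r (lsubmx z) =
  lam ord0 ord0 r
  + (yphi (lsubmx z))^-1 * \sum_(i < n) a (lift ord0 i) ord0 r * lsubmx z ord0 i.
Proof.
move=> Uz; have y0 : yphi (lsubmx z) != 0 by rewrite gt_eqF// yphi_gt0.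
apply: (mulfI y0); rewrite mulrDr /lam_tilde !mulrA divff// !mul1r.
rewrite /yphi mulrDl mul1r -addrA; congr (_ + _).
rewrite mulr_suml -big_split; apply: eq_bigr => i _ /=; rewrite !mxE; ring.
Qed.

Lemma J0_reduced z j : J0 reduced z ord0 (lshift k j) =
  J0 q z ord0 (lshift k j) - logdrift (lift ord0 j) * lsubmx z ord0 j.
Proof.
rewrite !J0El.
have -> : logdrift (lift ord0 j) * lsubmx z ord0 j =
    \sum_i (logdrift (lift ord0 j) *+ (i == lift ord0 j)) * ext_phi (lsubmx z) i.
  rewrite (bigD1 (lift ord0 j))//= eqxx ext_phi_lift big1 ?addr0// => i /negbTE ->.
  by rewrite mul0r.
rewrite -sumrB; apply: eq_bigr => i _; rewrite reduced0 mxE; ring.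
Qed.

Lemma D0JE phi j : D0J q lam phi ord0 j =
  (yphi phi)^-1 * (\sum_(i < n)
     Sig lam (lift ord0 i) (lift ord0 j) * phi ord0 i * phi ord0 j)
  - 2^-1 * dotr (a (lift ord0 j)) (a (lift ord0 j)) * phi ord0 j
  + J q phi ord0 j.
Proof. by rewrite [LHS]mxE [X in X + _ = _]mxE. Qed.

(** Because [lam_i = lam_0 + a_i], the [Dtilde] combination reproduces the [Sig] terms of [D0]
    exactly and adds [lam_0 . a_j] times [phi_j]; the compensating linear terms sit on the diagonal
    of [reduced]. *)
Lemma Dhat0E z : U z -> Dhat0 q lam z =
  \sum_r lam_tilde lam r (lsubmx z) *: Dtilde lam r z + J0 reduced z.
Proof.
move=> Uz; apply: row_ext => i; rewrite [RHS]mxE summxE.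
case: (split_ordP i) => j ->; last first.
  rewrite row_mxEr J0Er addr0 mxE (bigD1 j)//= mxE row_mxEr !mxE !eqxx mulr1.
  rewrite big1 ?addr0// => r rj.
  by rewrite mxE row_mxEr mxE eqxx/= eq_sym (negbTE rj) mulr0.
rewrite J0_reduced [LHS]row_mxEl D0JE [J0 _ _ _ _]row_mxEl.
set y := (yphi _)^-1; set phi := lsubmx z.
have termE r : (lam_tilde lam r phi *: Dtilde lam r z) ord0 (lshift k j) =
    (lam ord0 ord0 r + y * \sum_(i < n) a (lift ord0 i) ord0 r * phi ord0 i)
     * (a (lift ord0 j) ord0 r * phi ord0 j).
  by rewrite mxE Dtilde_linear linear_fieldEl (lam_tildeE _ Uz).
rewrite (eq_bigr _ (fun r _ => termE r)).
rewrite /logdrift.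
have -> : \sum_r
    (lam ord0 ord0 r + y * \sum_(i < n) a (lift ord0 i) ord0 r * phi ord0 i)
     * (a (lift ord0 j) ord0 r * phi ord0 j) =
  dotr (lam ord0) (a (lift ord0 j)) * phi ord0 j +
  y * \sum_(i < n) Sig lam (lift ord0 i) (lift ord0 j) * phi ord0 i * phi ord0 j.
  under eq_bigr do rewrite mulrDl; rewrite big_split; congr (_ + _).
    by rewrite /dotr mulr_suml; apply: eq_bigr => r _; rewrite mulrA.
  rewrite /Sig /dotr; under eq_bigr do rewrite -mulrA; rewrite -mulr_sumr.
  congr (_ * _); under [RHS]eq_bigr do rewrite -mulrA mulr_suml.
  rewrite exchange_big; apply: eq_bigr => r _; rewrite mulr_suml.
  by apply: eq_bigr => i' _; ring.
ring.
Qed.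

(** Together with the [Dtilde_r], the given linear fields form a commuting frame of [m + k < n + k]
    fields containing [Dhat0]. *)
Lemma not_hormander_few_linear_fields (m : nat) (c : 'I_m -> 'I_n -> R)
    (f : 'I_m -> 'rV[R]_(n + k) -> R) :
  (m < n)%N -> (forall t, regular (f t)) ->
  (forall z, U z -> J0 reduced z = \sum_t f t z *: linear_field (c t) 0 z) ->
  ~ L_hormander q lam.
Proof.
move=> mn rf Jf.
pose K (s : 'I_m + 'I_k) : @vfield R (n + k) :=
  match s with inl t => linear_field (c t) 0 | inr r => Dtilde lam r end.
apply: (not_hormander_frame (K := K)).
- by move=> [t|r] i; [|rewrite /K Dtilde_linear]; exact: regular_linear_field.
- by move=> [t|r] [t'|r'] i z _; rewrite /K ?Dtilde_linear; exact: linear_field_comm.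
- by rewrite card_sum !card_ord ltn_add2r.
- exists (fun s z =>
    match s with inl t => f t z | inr r => lam_tilde lam r (lsubmx z) end).
    by case=> [t|r] //; exact: regular_lam_tilde.
  by move=> z Uz; rewrite big_sumType/= -Jf// addrC Dhat0E.
- move=> r; exists (fun s _ => (s == inr r)%:R) => [s|z _]; first exact: regular_cst.
  rewrite (bigD1 (inr r))//= eqxx scale1r big1 ?addr0// => s /negbTE ->.
  by rewrite scale0r.
Qed.

(** Column 0 of [h] multiplies every [phi_j] by the same factor, which gives a multiple of the Euler
    field. *)
Lemma J0_diag h z : (forall j i, i != lift ord0 j -> h i (lift ord0 j) = 0) ->
  J0 h z = linear_field (fun j => h (lift ord0 j) (lift ord0 j)) 0 z
    - (\sum_i h i ord0 * ext_phi (lsubmx z) i) *: linear_field (fun=> 1) 0 z.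
Proof.
move=> hd; apply: row_ext => i.
have subZE (u v : 'rV[R]_(n + k)) c : (u - c *: v) ord0 i = u ord0 i - c * v ord0 i.
  by rewrite !mxE.
rewrite subZE; clear subZE.
case: (split_ordP i) => j ->; last by rewrite J0Er !linear_fieldEr !mxE mulr0 subr0.
rewrite J0El !linear_fieldEl.
under eq_bigr do rewrite mulrBl; rewrite sumrB; congr (_ - _).
  rewrite (bigD1 (lift ord0 j))//= ext_phi_lift big1 ?addr0// => p pj.
  by rewrite hd// mul0r.
rewrite mul1r mulr_suml; apply: eq_bigr => p _.
by rewrite -!mulrA (mulrC (ext_phi _ _)).
Qed.

(** * Bracket words and their values at a point *)

Section Spanning.
Variable z : 'rV[R]_(n + k).
Hypothesis Uz : U z.

Let S := linear_span
  [set F z | F in iterated_bracket ([set Dhat0 q lam] `|` range (Dtilde lam))].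

Lemma Dtilde_in_span r : S (Dtilde lam r z).
Proof.
by apply: linear_span_sub; exists (Dtilde lam r) => //; constructor; right; exists r.
Qed.

Definition ad_word (s : seq 'I_k) : @vfield R (n + k) :=
  foldr (fun r F => lie_bracket (Dtilde lam r) F) (Dhat0 q lam) s.

Lemma iterated_bracket_ad_word s :
  iterated_bracket ([set Dhat0 q lam] `|` range (Dtilde lam)) (ad_word s).
Proof.
elim: s => [|r s IH]; first by constructor; left.
by apply: iterated_bracket_lie => //; constructor; right; exists r.
Qed.

Definition word_weight (s : seq 'I_k) : 'M[R]_n.+1 :=
  \matrix_(i, j) ((\prod_(r <- s) weight r i j) * reduced i j).

(** Bracketing with [Dtilde_t] preserves this shape: the [Dtilde_r] commute, so only the [g_r] are
    differentiated, and the [J0] part is multiplied entrywise by [weight t]. *)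
Lemma ad_wordE s : exists2 g : 'I_k -> 'rV[R]_(n + k) -> R,
  forall r, regular (g r) &
  forall z, U z -> ad_word s z =
    \sum_r g r z *: Dtilde lam r z + J0 (word_weight s) z.
Proof.
elim: s => [|t s [g rg sE]].
  exists (fun r z => lam_tilde lam r (lsubmx z)); first exact: regular_lam_tilde.
  move=> w Uw; rewrite /= Dhat0E//; congr (_ + J0 _ _).
  by apply/matrixP => i j; rewrite [RHS]mxE big_nil mul1r.
exists (fun r z => 'D_(Dtilde lam t z) (g r) z).
  by move=> r; apply: regular_derive => // i; exact: regular_linear_field.
move=> w Uw.
have -> : word_weight (t :: s) = \matrix_(i, j) (weight t i j * word_weight s i j).
  by apply/matrixP => i j; rewrite !mxE big_cons mulrA.
rewrite -lie_bracket_Dtilde_J0//; apply: row_ext => i.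
rewrite [ad_word _]/= !mxE summxE /vapp.
have rD r := regular_linear_field (fun j => a (lift ord0 j) ord0 r) (delta_mx ord0 r) i.
have sD v : 'D_v (fun w => ad_word s w ord0 i) w =
    \sum_r (g r w * 'D_v (fun w => Dtilde lam r w ord0 i) w
            + Dtilde lam r w ord0 i * 'D_v (g r) w)
    + 'D_v (fun w => J0 (word_weight s) w ord0 i) w.
  rewrite (eq_derive_orthant (g := fun w =>
     \sum_r (g r w * Dtilde lam r w ord0 i) + J0 (word_weight s) w ord0 i) _ Uw).
    rewrite derive_add; [|apply: differentiable_regular..] => //.
    - rewrite derive_bigsum => [|r].
        congr (_ + _); apply: eq_bigr => r _; rewrite derive_mul//.
          exact: differentiable_regular.
        exact: differentiable_regular (rD r).
      by apply: differentiable_regular => //; apply: regularM => //; exact: rD.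
    - by apply: regular_sum => r; apply: regularM => //; exact: rD.
    - exact: regular_J0.
  move=> w' Uw'; rewrite sE// mxE summxE; congr (_ + _).
  by apply: eq_bigr => r _; rewrite mxE.
rewrite sD (sE _ Uw).
have dD : differentiable (fun w => Dtilde lam t w ord0 i) w.
  exact: differentiable_regular (rD t).
rewrite [in 'D_(_ + _) _ _]deriveE// linearD -!deriveE// derive_dir_sum//.
rewrite big_split/=.
(* Commutation of [Dtilde_t] with [Dtilde_r] makes the terms carrying an undifferentiated [g_r]
   cancel. *)
under [X in X + _ + _ - _]eq_bigr => r _ do
  rewrite -[X in _ * X](linear_field_comm _ _ _ _ _ w).
under [X in _ = X + _]eq_bigr => r _ do rewrite mxE mulrC.
rewrite /vapp -!Dtilde_linear; ring.
Qed.

Lemma word_weight_in_span s : S (J0 (word_weight s) z).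
Proof.
have [g _ sE] := ad_wordE s.
have -> : J0 (word_weight s) z = ad_word s z - \sum_r g r z *: Dtilde lam r z.
  by rewrite sE// addrAC subrr add0r.
apply: linear_spanB.
  apply: linear_span_sub; exists (ad_word s) => //.
  exact: iterated_bracket_ad_word.
by apply: linear_span_sum => r; apply: linear_spanZ; exact: Dtilde_in_span.
Qed.

(** The [x]-parts of the [Dtilde_r] form the standard basis, so only the [phi]-directions remain to
    be found. *)
Lemma span_full : (forall j, S (row_mx (delta_mx ord0 j) 0)) -> S = setT.
Proof.
move=> Sd; apply/seteqP; split => // v _.
have Sl (u : 'rV[R]_n) : S (row_mx u 0).
  have -> : row_mx u 0 = \sum_j u ord0 j *: row_mx (delta_mx ord0 j) (0 : 'rV[R]_k).
    under eq_bigr do rewrite scale_row_mx scaler0.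
    apply: row_ext => i; rewrite summxE; case: (split_ordP i) => j ->.
      rewrite row_mxEl (bigD1 j)//= row_mxEl !mxE !eqxx mulr1 big1 ?addr0// => p pj.
      by rewrite row_mxEl !mxE eqxx/= eq_sym (negbTE pj) mulr0.
    by rewrite big1 => [|p _]; rewrite row_mxEr mxE.
  by apply: linear_span_sum => j; exact: linear_spanZ (Sd j).
(* [w] is chosen with the same [x]-part as [v]. *)
pose w := \sum_r rsubmx v ord0 r *: Dtilde lam r z.
have -> : v = row_mx (lsubmx (v - w)) 0 + w.
  rewrite -[LHS](subrK w); congr (_ + _); rewrite -[LHS]hsubmxK; congr row_mx.
  apply: row_ext => r; rewrite !mxE summxE (bigD1 r)//= mxE row_mxEr !mxE !eqxx mulr1.
  rewrite big1 ?addr0 ?subrr// => p pr.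
  by rewrite mxE row_mxEr !mxE eqxx/= eq_sym (negbTE pr) mulr0.
apply: (linear_spanD (Sl _)); apply: linear_span_sum => r; apply: linear_spanZ.
exact: Dtilde_in_span.
Qed.

End Spanning.

End Fields.

(** * Isolating single entries by joint eigenvalues *)

Section Sufficient.
Context {R : realType} {n k : nat} (q : 'M[R]_n.+1) (lam : 'I_n.+1 -> 'rV[R]_k).
Local Notation U := (@orthant_times_space R n k).
Local Notation a := (avec lam).
Local Notation span_at z := (linear_span
  [set F z | F in iterated_bracket ([set Dhat0 q lam] `|` range (Dtilde lam))]).

(** The eigenvalue on entry [(i, j)] of the product of the operators [ad Dtilde_r - c] over the
    pairs [(r, c)] of [L]. *)
Definition shifted_weight (L : seq ('I_k * R)) (i j : 'I_n.+1) : R :=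
  \prod_(x <- L) (weight lam x.1 i j - x.2).

(* The entries of [reduced] sharing a value of [a_i - a_j] are separated from
   the others by applying the operators [ad Dtilde_r - c] of [L]. *)
Lemma shifted_weight_in_span (L : seq ('I_k * R)) z : U z ->
  span_at z (J0 (\matrix_(i, j) (shifted_weight L i j * reduced q lam i j)) z).
Proof.
move=> Uz.
(* Quantifying over words lets the induction on [L] realise [ad Dtilde_r] by prefixing [r] to
   [s]. *)
suff all_words s : span_at z (J0 (\matrix_(i, j) (shifted_weight L i j
    * word_weight q lam s i j)) z).
  have := all_words [::]; congr (linear_span _ (J0 _ _)); apply/matrixP => i j.
  by rewrite !mxE big_nil mul1r.
elim: L s => [|[r c] L IH] s.
  have := word_weight_in_span q lam Uz s; congr (linear_span _ (J0 _ _)).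
  by apply/matrixP => i j; rewrite [RHS]mxE /shifted_weight big_nil mul1r.
have := linear_spanB (IH (r :: s)) (linear_spanZ c (IH s)).
rewrite -J0Z -scaleN1r -J0Z -J0D; congr (linear_span _ (J0 _ _)).
by apply/matrixP => i j; rewrite !mxE /shifted_weight !big_cons /=; ring.
Qed.

Lemma isolated_entry_in_span z (m i : 'I_n.+1) : U z ->
  (forall p j, a p - a j = a m - a i -> (p, j) != (m, i) -> reduced q lam p j = 0) ->
  span_at z (J0 (reduced q lam m i *: delta_mx m i) z).
Proof.
move=> Uz isolated.
pose sep (x : 'I_n.+1 * 'I_n.+1) (r : 'I_k) :=
  weight lam r x.1 x.2 != weight lam r m i.
(* One factor for each pair whose eigenvalue differs from that of [(m, i)] in some coordinate [r]:
   it kills that pair but not [(m, i)]. Pairs with the same eigenvalue give no factor; [isolated]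
   makes their entries zero. *)
pose L := pmap (fun x => omap (fun r => (r, weight lam r x.1 x.2)) [pick r | sep x r])
  (enum {: 'I_n.+1 * 'I_n.+1}).
have Lmi : shifted_weight L m i != 0.
  rewrite prodf_seq_neq0; apply/allP => y; rewrite mem_pmap => /mapP[x _].
  by case: pickP => //= r xr [->]; rewrite subr_eq0 eq_sym.
have Lpj p j : (p, j) != (m, i) -> shifted_weight L p j * reduced q lam p j = 0.
  move=> pj; have [r|none] := pickP (sep (p, j)); last first.
    rewrite (isolated p j) ?mulr0//; apply/rowP => r.
    by have /negbFE/eqP := none r; rewrite /weight !mxE.
  move=> rsep; apply/eqP; rewrite mulf_eq0; apply/orP; left.
  rewrite prodf_seq_eq0; apply/hasP.
  have : [pick r | sep (p, j) r] != None by case: pickP => // /(_ r); rewrite rsep.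
  case E : [pick r | sep (p, j) r] => [t|//] _.
  exists (t, weight lam t p j); last by rewrite subrr eqxx.
  by rewrite mem_pmap; apply/mapP; exists (p, j); rewrite ?mem_enum//= E.
have := linear_spanZ (shifted_weight L m i)^-1 (shifted_weight_in_span L Uz).
rewrite -J0Z; congr (linear_span _ (J0 _ _)); apply/matrixP => p j; rewrite !mxE.
have [[-> ->]|pj] := eqVneq (p, j) (m, i); first by rewrite !eqxx mulr1 mulKf.
have := Lpj p j pj; rewrite [reduced _ _ _ _]mxE => ->; rewrite mulr0.
by move: pj; rewrite xpair_eqE => /negbTE->; rewrite mulr0.
Qed.

Lemma J0_delta (z : 'rV[R]_(n + k)) (m : 'I_n.+1) (i : 'I_n) :
  J0 (delta_mx m (lift ord0 i)) z = ext_phi (lsubmx z) m *: row_mx (delta_mx ord0 i) 0.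
Proof.
rewrite scale_row_mx scaler0; congr row_mx; apply: row_ext => j; rewrite !mxE eqxx/=.
rewrite (bigD1 m)//= big1 ?addr0 => [|p /negbTE pm]; rewrite !mxE ?eqxx ?pm /=.
  by rewrite (inj_eq lift_inj) mul0r subr0 mulrC.
by rewrite mul0r subr0 mul0r.
Qed.

(** An isolated entry [(m, i)] gives the field [phi_m] times the [i]-th coordinate field, and
    [phi_m] is positive. *)
Lemma hormander_isolated :
  (forall i, i != ord0 -> exists m, reduced q lam m i != 0 /\
    forall p j, a p - a j = a m - a i -> (p, j) != (m, i) -> reduced q lam p j = 0) ->
  L_hormander q lam.
Proof.
move=> isolated z Uz; apply: span_full => // i.
have i0 : lift ord0 i != ord0 by rewrite eq_sym neq_lift.
have [m [qmi sep]] := isolated _ i0.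
pose c := reduced q lam m (lift ord0 i) * ext_phi (lsubmx z) m.
have c0 : c != 0 by rewrite mulf_neq0// gt_eqF// ext_phi_gt0.
have := linear_spanZ c^-1 (isolated_entry_in_span Uz sep).
by rewrite J0Z J0_delta !scalerA -mulrA (mulVf c0) scale1r.
Qed.

End Sufficient.

(** * Chains whose only off-diagonal transitions lead to state 0 *)

Section OnlyExitToZero.
Context {R : realType} {n k : nat} (q : 'M[R]_n.+1) (lam : 'I_n.+1 -> 'rV[R]_k).
Local Notation U := (@orthant_times_space R n k).
Local Notation a := (avec lam).
Hypothesis q_row_sum0 : forall i, \sum_(j < n.+1) q i j = 0.
Hypothesis q_off0 : forall j, j != ord0 -> forall m, m != j -> q m j = 0.

Definition exit_rate (z : 'rV[R]_(n + k)) : R :=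
  \sum_i q i ord0 * ext_phi (@lsubmx R 1 n k z) i.

Definition linear_rate (j : 'I_n.+1) : R := q j ord0 + logdrift lam j.

Lemma regular_exit_rate : regular exit_rate.
Proof.
apply: regular_sum => p; apply: regularM; [exact: regular_cst|exact: regular_ext_phi].
Qed.

Lemma q_diag j : j != ord0 -> q j j = - q j ord0.
Proof.
move=> j0; apply/eqP; rewrite -addr_eq0 addrC -(q_row_sum0 j) (bigD1 ord0)//=.
rewrite (bigD1 j)//= big1 ?addr0// => i /andP[i0 ij].
by apply: q_off0 => //; rewrite eq_sym.
Qed.

Lemma reduced_off0 i j : i != lift ord0 j -> reduced q lam i (lift ord0 j) = 0.
Proof. by move=> ij; rewrite mxE (negbTE ij) subr0 q_off0// eq_sym neq_lift. Qed.

Lemma J0_reduced_exit z : J0 (reduced q lam) z =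
  linear_field (fun j => - linear_rate (lift ord0 j)) 0 z
  - exit_rate z *: linear_field (fun=> 1) 0 z.
Proof.
rewrite J0_diag; last by move=> j i; exact: reduced_off0.
congr (row_mx _ _ - _ *: _).
  apply: row_ext => j; rewrite !mxE eqxx q_diag 1?eq_sym ?neq_lift//.
  by rewrite /linear_rate (opprD (q _ _)).
by apply: eq_bigr => i _; rewrite reduced0.
Qed.

Lemma not_hormander_exit : (2 < n)%N -> ~ L_hormander q lam.
Proof.
move=> n2.
pose c (b : 'I_2) (j : 'I_n) := if b == ord0 then - linear_rate (lift ord0 j) else 1.
pose f (b : 'I_2) z := if b == ord0 then 1 else - exit_rate z.
apply: (@not_hormander_few_linear_fields _ _ _ _ _ _ c f) => //.
  move=> b; rewrite /f; case: (b == ord0); first exact: regular_cst.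
  exact/regularN/regular_exit_rate.
move=> z _; rewrite J0_reduced_exit big_ord_recl big_ord1.
by rewrite /f /c /= scale1r scaleNr.
Qed.

(** With equal rates the linear part is itself a multiple of the Euler field, so one field
    suffices. *)
Lemma not_hormander_equal_rates (b : R) : (1 < n)%N ->
  (forall j, j != ord0 -> linear_rate j = b) -> ~ L_hormander q lam.
Proof.
move=> n1 rate_eq.
apply: (@not_hormander_few_linear_fields _ _ _ _ _ 1 (fun=> fun=> 1)
  (fun=> fun z => - b - exit_rate z)) => // [_|z _].
  by apply: regularB; [exact: regular_cst|exact: regular_exit_rate].
rewrite J0_reduced_exit big_ord_recl big_ord0 addr0 scalerBl; congr (_ - _).
rewrite scale_row_mx scaler0; congr row_mx; apply: row_ext => j.
by rewrite !mxE rate_eq 1?eq_sym ?neq_lift// mul1r.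
Qed.

Local Notation span_at z := (linear_span
  [set F z | F in iterated_bracket ([set Dhat0 q lam] `|` range (Dtilde lam))]).

Hypothesis q_off_ge0 : forall i j, i != j -> 0 <= q i j.

(* [ad Dtilde_r] twice turns the coefficient of the Euler field into
   [- \sum_i a_ir ^ 2 q_i0 phi_i], which cannot vanish. *)
Lemma euler_in_span z j : injective lam -> U z -> j != ord0 -> 0 < q j ord0 ->
  span_at z (linear_field (fun=> 1) 0 z).
Proof.
move=> lam_inj Uz j0 qj.
have /existsP[r ajr] : [exists r, a j ord0 r != 0].
  rewrite -negb_forall; apply/negP => /forallP aj0; move/eqP: j0; apply.
  apply: lam_inj; apply: row_ext => r.
  by have /eqP := aj0 r; rewrite !mxE => /subr0_eq.
pose c := \sum_i word_weight q lam [:: r; r] i ord0 * ext_phi (lsubmx z) i.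
have c_gt0 : 0 < c.
  have wE i : word_weight q lam [:: r; r] i ord0 = a i ord0 r ^+ 2 * q i ord0.
    rewrite mxE !big_cons big_nil mulr1 reduced0 /weight avec0 [X in _ - X]mxE subr0.
    by rewrite expr2.
  rewrite /c (bigD1 j)//= ltr_pwDl//.
    by rewrite wE mulr_gt0 ?ext_phi_gt0// mulr_gt0// exprn_even_gt0.
  rewrite sumr_ge0// => i _; rewrite wE mulr_ge0 ?(ltW (ext_phi_gt0 _ Uz))//.
  (* The entry [q 0 0] may be negative, but its weight is 0 because [a_0 = 0]. *)
  have [->|i0] := eqVneq i ord0; first by rewrite avec0 mxE expr2 !mul0r.
  by rewrite mulr_ge0 ?sqr_ge0 ?q_off_ge0.
have := linear_spanZ (- c^-1) (word_weight_in_span q lam Uz [:: r; r]).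
congr (linear_span _ _); rewrite J0_diag => [|i m mi]; last first.
  by rewrite mxE reduced_off0// mulr0.
(* Diagonal entries have weight [a_i - a_i = 0], so a single bracket already removes the linear
   part. *)
have -> : linear_field
    (fun j => word_weight q lam [:: r; r] (lift ord0 j) (lift ord0 j)) 0 z = 0.
  apply: row_ext => i; rewrite [RHS]mxE; case: (split_ordP i) => l ->; last first.
    by rewrite linear_fieldEr mxE.
  by rewrite linear_fieldEl mxE big_cons /weight subrr !mul0r.
by rewrite sub0r scaleNr scalerN opprK scalerA mulVf ?gt_eqF// scale1r.
Qed.

End OnlyExitToZero.

(** * The case [n = 2] with distinct rates *)

Section TwoCoordinates.
Context {R : realType} {k : nat} (q : 'M[R]_3) (lam : 'I_3 -> 'rV[R]_k).
Local Notation U := (@orthant_times_space R 2 k).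
Hypothesis q_row_sum0 : forall i, \sum_(j < 3) q i j = 0.
Hypothesis q_off0 : forall j, j != ord0 -> forall m, m != j -> q m j = 0.
Hypothesis q_off_ge0 : forall i j, i != j -> 0 <= q i j.

Lemma hormander_distinct_rates j : injective lam -> j != ord0 -> 0 < q j ord0 ->
  linear_rate q lam (inord 1) != linear_rate q lam (inord 2) -> L_hormander q lam.
Proof.
move=> lam_inj j0 qj rates z Uz; apply: span_full => //.
set S := linear_span _.
have euler : S (linear_field (fun=> 1) 0 z)
  by exact: (euler_in_span q_off0 q_off_ge0 lam_inj Uz j0 qj).
pose b i := linear_rate q lam (lift ord0 i).
(* The empty word gives the reduced drift itself; its Euler part is cancelled by a multiple of
   [euler]. *)
have drift : S (linear_field (fun i => b i) 0 z).
  have := word_weight_in_span q lam Uz [::].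
  have -> : word_weight q lam [::] = reduced q lam.
    by apply/matrixP => p i; rewrite [LHS]mxE big_nil mul1r.
  rewrite J0_reduced_exit// => Sd.
  have := linear_spanZ (-1) (linear_spanD Sd (linear_spanZ (exit_rate q z) euler)).
  rewrite subrK scale_row_mx scaler0; congr (linear_span _ (row_mx _ _)).
  by apply: row_ext => i; rewrite !mxE mulN1r mulNr opprK.
have lift1 : lift ord0 (ord0 : 'I_2) = inord 1 :> 'I_3.
  by apply: val_inj; rewrite /= inordK.
have lift2 : lift ord0 (ord_max : 'I_2) = inord 2 :> 'I_3.
  by apply: val_inj; rewrite /= inordK.
(* With only two indices, [drift] minus [b i'] times [euler] is supported on coordinate [i]. *)
have separate i i' : b i != b i' -> (forall l, l != i -> l = i') ->
    S (row_mx (delta_mx ord0 i) 0).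
  move=> bii' only; have c0 : (b i - b i') * lsubmx z ord0 i != 0.
    by rewrite mulf_neq0 ?subr_eq0// gt_eqF.
  have := linear_spanZ ((b i - b i') * lsubmx z ord0 i)^-1
    (linear_spanB drift (linear_spanZ (b i') euler)).
  congr (linear_span _ _); rewrite !scale_row_mx opp_row_mx add_row_mx scale_row_mx.
  rewrite scaler0 subrr scaler0; congr row_mx; apply: row_ext => l.
  rewrite !mxE; have [->|li] := eqVneq l i.
    by move: c0; rewrite mxE mul1r -mulrBl => c0; rewrite mulVf.
  by rewrite (only l li) mul1r subrr mulr0 andbF.
move=> i; have [->|i0] := eqVneq i ord0.
  apply: (separate _ ord_max); first by rewrite /b lift1 lift2.
  by move=> l l0; apply: val_inj; move: l l0 => [[|[|]]].
have -> : i = ord_max by apply: val_inj; move: i i0 => [[|[|]]].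
apply: (separate _ ord0); first by rewrite /b lift1 lift2 eq_sym.
by move=> l l0; apply: val_inj; move: l l0 => [[|[|]]].
Qed.

End TwoCoordinates.

(** * The three cases combined *)

Theorem corollary5p4 (R : realType) (k n : nat)
  (k_ge1 : (1 <= k)%N) (k_lt_n : (k < n)%N)
  (q : 'M[R]_n.+1)
  (q_off_ge0 : forall i j, i != j -> 0 <= q i j)
  (q_diag_le0 : forall i, q i i <= 0)
  (q_row_sum0 : forall i, \sum_(j < n.+1) q i j = 0)
  (lam : 'I_n.+1 -> 'rV[R]_k)
  (lam_inj : injective lam)
  (lam0_vertex : vertex (convex_hull lam) (lam ord0)) :
  let a := avec lam in
  [/\ q = 0 -> ~ L_hormander q lam,
      injective a ->
      (forall i : 'I_n.+1, i != ord0 ->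
         exists m : 'I_n.+1, [/\ m != i, 0 < q m i &
           forall p j : 'I_n.+1, 0 < q p j -> a p - a j = a m - a i -> j = i]) ->
      L_hormander q lam
    & (forall j : 'I_n.+1, j != ord0 ->
         forall m : 'I_n.+1, m != j -> q m j = 0) ->
      (exists2 j : 'I_n.+1, j != ord0 & 0 < q j ord0) ->
      ((3 <= n)%N -> ~ L_hormander q lam) /\
      (n = 2%N ->
         let a1 := a (inord 1) in
         let a2 := a (inord 2) in
         (L_hormander q lam <->
          q (inord 1) ord0 + 2^-1 * dotr a1 a1 + dotr (lam ord0) a1
            != q (inord 2) ord0 + 2^-1 * dotr a2 a2 + dotr (lam ord0) a2))].
Proof.
move=> a; split.
(* For [q = 0] the exit rate vanishes and one linear field remains; [1 <= k < n] provides
   [1 < n]. *)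
- move=> q0; apply: (@not_hormander_few_linear_fields _ _ _ _ _ 1
    (fun=> fun j => - linear_rate q lam (lift ord0 j)) (fun=> fun=> 1)).
  + exact: leq_ltn_trans k_lt_n.
  + by move=> _; exact: regular_cst.
  + move=> z _; rewrite big_ord_recl big_ord0 addr0 scale1r J0_reduced_exit//.
      by rewrite /exit_rate big1 ?scale0r ?subr0// => i _; rewrite q0 mxE mul0r.
    by move=> j _ m _; rewrite q0 mxE.
- move=> a_inj isolated; apply: hormander_isolated => i i0.
  have [m [mi qmi sep]] := isolated i i0.
  exists m; rewrite mxE (negbTE mi) subr0 gt_eqF//; split => // p j pj pjmi.
  (* Equality [p = j] would give [a_m = a_i]; hence no diagonal entry shares the eigenvalue, and
     [reduced] agrees with [q] here. *)
  have pj_neq : p != j.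
    apply: contraNneq mi => pj_eq; apply/eqP/a_inj; apply/subr0_eq.
    by rewrite -[LHS]pj pj_eq subrr.
  rewrite mxE (negbTE pj_neq) subr0; apply/eqP; apply: contraNT pjmi => qpj.
  have qpj_gt0 : 0 < q p j by rewrite lt0r qpj q_off_ge0.
  have ji := sep p j qpj_gt0 pj; rewrite ji in pj *.
  by rewrite (a_inj p m) ?eqxx//; exact: addIr pj.
- move=> q_off0 [j j0 qj]; split; first exact: not_hormander_exit.
  move=> n2; subst n; rewrite /=.
  have rateE i : linear_rate q lam i =
      q i ord0 + 2^-1 * dotr (a i) (a i) + dotr (lam ord0) (a i).
    by rewrite /linear_rate /logdrift addrA.
  rewrite -!rateE; split; last first.
    exact: (hormander_distinct_rates q_row_sum0 q_off0 q_off_ge0 lam_inj j0 qj).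
  move=> Lh; apply/eqP => rates.
  apply: (not_hormander_equal_rates (b := linear_rate q lam (inord 1))
    q_row_sum0 q_off0 _ _ Lh) => //.
  (* The only nonzero indices are 1 and 2, whose rates agree by assumption. *)
  move=> i i0; have [->//|i1] := eqVneq i (inord 1).
  rewrite rates; congr linear_rate; apply: val_inj.
  by move: i i0 i1 => [[|[|[|]]]] //= lt_i _; rewrite -val_eqE /= !inordK.
Qed.
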